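(* Let $I$ be a set of items and let $I_{u_1}, I_{u_2}\subseteq I$ be non-empty finite sets with $n:=|I_{u_1}\cup I_{u_2}|\ge 2$, and let $J_{u_1,u_2}=|I_{u_1}\cap I_{u_2}|/|I_{u_1}\cup I_{u_2}|$. Let $h_1,\dots,h_k : I\to(0,1)$ be independent random hash functions, each such that the values $h_i(v)$, $v\in I$, are independent and uniform on $(0,1)$; put $r_i(v)=\lfloor -\log_2 h_i(v)\rfloor$. For $u\in\{u_1,u_2\}$ and $1\le i\le k$ let $m_u[i]=\max_{w\in I_u} r_i(w)$, and let $s_u[i]=1$ if exactly one $w\in I_u$ satisfies $r_i(w)=m_u[i]$ and $s_u[i]=0$ otherwise. Let $\chi[i]=\mathbf{1}(m_{u_1}[i]\ne m_{u_2}[i])$; let $\psi[i]=s_{u_1}[i]$ if $m_{u_1}[i]>m_{u_2}[i]$, $\psi[i]=s_{u_2}[i]$ if $m_{u_1}[i]<m_{u_2}[i]$, and $\psi[i]=-1$ otherwise; let $\delta[i]=\mathbf{1}(\chi[i]=1)\mathbf{1}(\psi[i]=1)$. Let $\hat k=\sum_{i=1}^k\mathbf{1}(\delta[i]=1)$ and define the estimator $\hat J_{u_1,u_2}=1-\frac{\hat k}{k\alpha}$, where $\alpha=0.7213$. For $m\ge 2$ let $\alpha_m = m\sum_{j=1}^{\infty}\frac{1}{2^{j+1}}\left(1-\frac{1}{2^j}\right)^{m-1}$ and $\beta_m=\alpha_m/\alpha$. Then \[ \mathbb{E}(\hat J_{u_1,u_2})-J_{u_1,u_2}=(1-\beta_{n})(1-J_{u_1,u_2}),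 \] \[ \mathrm{Var}(\hat J_{u_1,u_2})=\frac{\beta_{n}(1-J_{u_1,u_2})\left(\alpha^{-1}-\beta_{n}(1-J_{u_1,u_2})\right)}{k}. \] Moreover, when $n\ge 3$, $|\beta_n-1|\le 0.01$.
   Context: This is the MaxLogHash sketch with $k$ registers; $\lfloor\cdot\rfloor$ is the floor function and $\mathbf{1}(\cdot)$ the indicator function. The constant $\alpha=0.7213$ is the paper's fixed approximation to $\alpha_m$. *)

(* Defs.v *)
From HB Require Import structures.
From mathcomp Require Import all_boot all_order all_algebra finmap.
From mathcomp Require Import all_classical all_reals all_analysis.

Set Implicit Arguments.
Unset Strict Implicit.
Unset Printing Implicit Defensive.

Import Order.TTheory GRing.Theory Num.Theory.
Import numFieldNormedType.Exports.

Local Open Scope classical_set_scope.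
Local Open Scope ring_scope.

(* Mutual independence of a family of classes of events: the product rule over
   every finite subfamily. *)
Definition independent_classes d (T : measurableType d) (R : realType)
    (P : probability T R) (K : choiceType) (F : K -> set_system T) : Prop :=
  forall (S : {fset K}) (E : K -> set T), (forall i, i \in S -> F i (E i)) ->
    P (\bigcap_(i in [set` S]) E i) = (\prod_(i <- S) P (E i))%E.

Definition sigma_rv d (T : measurableType d) (R : realType) (X : T -> R) :
    set_system T :=
  preimage_set_system setT X measurable.

(* The sigma-algebra of the random function v |-> X v, the space of functions
   V -> R carrying its product (cylinder) sigma-algebra. *)
Definition sigma_random_fun d (T : measurableType d) (R : realType) (V : Type)
    (X : V -> T -> R) : set_system T :=
  <<s \bigcup_v sigma_rv (X v) >>.

Definition independent_rvs d (T : measurableType d) (R : realType)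
    (P : probability T R) (V : choiceType) (X : V -> T -> R) : Prop :=
  independent_classes P (fun v => sigma_rv (X v)).

Definition independent_random_funs d (T : measurableType d) (R : realType)
    (P : probability T R) (K : choiceType) (V : Type) (X : K -> V -> T -> R) :
    Prop :=
  independent_classes P (fun i => sigma_random_fun (X i)).

Definition uniform01 d (T : measurableType d) (R : realType)
    (P : probability T R) (X : {RV P >-> R}) : Prop :=
  forall B : set R, measurable B ->
    distribution P X B = uniform_prob (@ltr01 R) B.

Definition log2 (R : realType) (x : R) : R := ln x / ln 2.

Definition hash_rank (R : realType) (x : R) : int := Num.floor (- log2 x).

(* In the definitions below, r : I -> int gives the ranks of the items under one
   hash function, and A, A1, A2 are sets of items. *)

(* The default value 0 of the iterated maximum plays no role for a non-empty A
   and ranks of hash values in (0, 1), which are nonnegative. *)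
Definition reg_max (I : choiceType) (r : I -> int) (A : {fset I}) : int :=
  \big[Num.max/0]_(w <- A) r w.

Definition reg_flag (I : choiceType) (r : I -> int) (A : {fset I}) : int :=
  if #|` [fset w in A | r w == reg_max r A]%fset | == 1%N then 1 else 0.

Definition chi (I : choiceType) (r : I -> int) (A1 A2 : {fset I}) : nat :=
  (reg_max r A1 != reg_max r A2).

Definition psi (I : choiceType) (r : I -> int) (A1 A2 : {fset I}) : int :=
  if reg_max r A2 < reg_max r A1 then reg_flag r A1
  else if reg_max r A1 < reg_max r A2 then reg_flag r A2
  else -1.

Definition delta (I : choiceType) (r : I -> int) (A1 A2 : {fset I}) : nat :=
  ((chi r A1 A2 == 1) * (psi r A1 A2 == 1))%N.

Definition khat d (T : measurableType d) (R : realType) (I : choiceType)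
    (k : nat) (h : 'I_k -> I -> T -> R) (A1 A2 : {fset I}) (t : T) : nat :=
  (\sum_(i < k) (delta (fun v => hash_rank (h i v t)) A1 A2 == 1))%N.

Definition alpha (R : realType) : R := 7213%:R / 10 ^+ 4.

Definition Jhat d (T : measurableType d) (R : realType) (I : choiceType)
    (k : nat) (h : 'I_k -> I -> T -> R) (A1 A2 : {fset I}) (t : T) : R :=
  1 - (khat h A1 A2 t)%:R / (k%:R * alpha R).

Definition jaccard (R : realType) (I : choiceType) (A1 A2 : {fset I}) : R :=
  (#|` A1 `&` A2|%fset)%:R / (#|` A1 `|` A2|%fset)%:R.

Definition alpha_ (R : realType) (m : nat) : R :=
  m%:R * \big[+%R/0]_(1 <= j <oo)
    ((2 ^+ j.+1)^-1 * (1 - (2 ^+ j)^-1) ^+ m.-1 : R).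

Definition beta_ (R : realType) (m : nat) : R := alpha_ R m / alpha R.

(* Main.v *)
(* For one hash function, delta = 1 exactly when the rank has a unique maximiser
   over the union of the two sets and that maximiser lies in their symmetric
   difference.  Summing over the maximiser w and its rank j >= 0,
   P(delta = 1) = (1 - J) n sum_j 2^-(j+1) (1 - 2^-j)^(n-1) = (1 - J) alpha_n,
   and khat is a sum of k pairwise independent such indicators.

   For the bound on beta_n, let p_n be the probability that n geometric ranks
   have a unique maximum, so that p_n = alpha_n for n >= 2.  Removing the items
   of rank 0 gives 2^n p_n = sum_(k <= n) C(n, k) p_k.  Hence
   d_k = a - c / 2^k + e p_k satisfies
   2^n d_n = c ((3/2)^n - 1) + sum_(k <= n) C(n, k) d_k, and the exponential gain
   outweighs the terms k < 4, which are known exactly; so d_n >= 0 follows by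
   strong induction from n = 4, both for e = 1 and for e = -1. *)
Require Import Defs.
From HB Require Import structures.
From mathcomp Require Import all_boot all_order all_algebra finmap.
From mathcomp Require Import all_classical all_reals all_analysis.
From mathcomp Require Import ring lra.

Set Implicit Arguments.
Unset Strict Implicit.
Unset Printing Implicit Defensive.

Import Order.TTheory GRing.Theory Num.Theory.
Import numFieldNormedType.Exports.

Local Open Scope classical_set_scope.
Local Open Scope ring_scope.

Lemma inv_exp2_itv (R : realType) n : 0 <= (2 ^+ n)^-1 :> R /\ (2 ^+ n)^-1 <= 1 :> R.
Proof.
split; first by rewrite invr_ge0 exprn_ge0 ?ler0n.
by rewrite invf_le1 ?exprn_gt0// exprn_ege1// ler1n.
Qed.

(** * The probability of a unique maximum: its series, recursion and first values *)

Section alpha_bounds.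
Variable R : realType.
Implicit Types (m n j q : nat).

Definition win_term q j : R := (2 ^+ j.+1)^-1 * (1 - (2 ^+ j)^-1) ^+ q.

(** The series starts at j = 0, one term before that of [alpha_]. The extra term vanishes for n >=
    2; at n = 1 it supplies the 1/2 that makes [win_prob 1] equal to 1. *)
Definition win_prob n : R := n%:R * limn (series (win_term n.-1)).

Lemma win_term_ge0 q j : 0 <= win_term q j.
Proof.
rewrite mulr_ge0 ?invr_ge0 ?exprn_ge0 ?ler0n// subr_ge0 invf_le1 ?exprn_gt0//.
by rewrite exprn_ege1// ler1n.
Qed.

Lemma win_term_le q j : win_term q j <= geometric (2^-1) (2^-1) j.
Proof.
rewrite /= -exprS exprVn ler_piMr ?invr_ge0 ?exprn_ge0 ?ler0n//.
rewrite exprn_ile1 ?gerBl ?invr_ge0 ?exprn_ge0 ?ler0n// subr_ge0.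
by rewrite invf_le1 ?exprn_gt0// exprn_ege1// ler1n.
Qed.

Lemma is_cvg_series_win q : cvgn (series (win_term q)).
Proof.
apply: (series_le_cvg (win_term_ge0 q) _ (win_term_le q)) => [j|].
  by rewrite /= mulr_ge0// exprn_ge0.
by apply: is_cvg_geometric_series; rewrite ger0_norm// invf_lt1// ltr1n.
Qed.

Lemma win_term0 q : (0 < q)%N -> win_term q 0 = 0.
Proof. by move=> q0; rewrite /win_term expr0 invr1 subrr expr0n eqn0Ngt q0/= mulr0. Qed.

Lemma alpha_win_prob n : (2 <= n)%N -> alpha_ R n = win_prob n.
Proof.
move=> n2; rewrite /alpha_ /win_prob; congr (_ * _).
apply: (congr1 (fun u : R^nat => limn u)); apply/funext => N /=.
rewrite /series/=; case: N => [|N]; first by rewrite !big_geq.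
by rewrite [RHS]big_ltn// win_term0 ?add0r//; case: n n2 => [|[]].
Qed.

(* [2 - 2^-j = 2 (1 - 2^-(j+1))], so the binomial transform shifts the index. *)
Lemma binomial_win_term q j :
  \sum_(k < q.+1) 'C(q, k)%:R * win_term k j = 2 ^+ q.+1 * win_term q j.+1.
Proof.
under eq_bigr do rewrite /win_term mulrCA mulr_natl.
rewrite -mulr_sumr; set x : R := 1 - _.
have -> : \sum_(k < q.+1) x ^+ k *+ 'C(q, k) = (1 + x) ^+ q.
  by rewrite exprDn; apply: eq_bigr => k _; rewrite expr1n mul1r.
have -> : 1 + x = 2 * (1 - (2 ^+ j.+1)^-1).
  by rewrite /x exprS invfM; field; rewrite expf_neq0.
rewrite exprMn_comm; last exact: mulrC.
rewrite /win_term !exprS; field.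
by rewrite expf_neq0.
Qed.

(** Shifting the index leaves out the term j = 0 on the right, and this term is zero because q >
    0. *)
Lemma series_winS q N : (0 < q)%N ->
  \sum_(k < q.+1) 'C(q, k)%:R * series (win_term k) N =
  2 ^+ q.+1 * series (win_term q) N.+1.
Proof.
move=> q0; rewrite {2}/series/= big_nat_recl// win_term0// add0r mulr_sumr.
under [RHS]eq_bigr do rewrite -binomial_win_term.
rewrite exchange_big/=; apply: eq_bigr => k _.
by rewrite /series/= mulr_sumr.
Qed.

Lemma lim_series_winS q : (0 < q)%N ->
  \sum_(k < q.+1) 'C(q, k)%:R * limn (series (win_term k)) =
  2 ^+ q.+1 * limn (series (win_term q)).
Proof.
move=> q0.
have L : (fun N => \sum_(k < q.+1) 'C(q, k)%:R * series (win_term k) N) @ \oo -->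
    \sum_(k < q.+1) 'C(q, k)%:R * limn (series (win_term k)).
  apply: cvg_big => [|k _]; first exact: add_continuous.
  by apply: cvgMl_tmp; exact: is_cvg_series_win.
apply: (cvg_unique _ L) => //.
rewrite (_ : (fun N => _) = fun N => 2 ^+ q.+1 * series (win_term q) N.+1); last first.
  by apply/funext => N; rewrite series_winS.
apply: cvgMl_tmp.
by have := @is_cvg_series_win q; rewrite -(cvg_shiftS (series (win_term q))).
Qed.

(** The absorption identity k C(n, k) = n C(n - 1, k - 1) trades the factor k of [win_prob k] for n,
    which leaves the transform of the limits at n - 1. *)
Lemma win_prob_rec n : (2 <= n)%N ->
  2 ^+ n * win_prob n = \sum_(k < n.+1) 'C(n, k)%:R * win_prob k.
Proof.
case: n => // q; rewrite ltnS => q0.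
rewrite big_ord_recl {2}/win_prob mul0r mulr0 add0r.
rewrite {1}/win_prob mulrCA -lim_series_winS// mulr_sumr.
apply: eq_bigr => k _; rewrite /win_prob/= !mulrA -!natrM.
by rewrite mulnC (mulnC 'C(_, _)) /bump/= add1n mul_bin_diag mulnC.
Qed.

Lemma win_prob0 : win_prob 0 = 0. Proof. by rewrite /win_prob mul0r. Qed.

Lemma win_prob1 : win_prob 1 = 1.
Proof.
rewrite /win_prob mul1r.
have -> : win_term 0 = geometric (2^-1) (2^-1).
  by apply/funext => j; rewrite /win_term/= expr0 mulr1 -exprS exprVn.
have /cvg_lim-> // : series (geometric (2^-1 : R) (2^-1)) @ \oo -->
    (2^-1 * (1 - 2^-1)^-1 : R).
  by apply: cvg_geometric_series; rewrite ger0_norm// invf_lt1// ltr1n.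
by rewrite (_ : 1 - 2^-1 = 2^-1 :> R) ?invrK ?mulVf//; lra.
Qed.

(** The recursion has [win_prob n] on both sides, with coefficients 2^n and 1, so the smaller values
    determine it; likewise for n = 3 and n = 4. *)
Lemma win_prob2 : win_prob 2 = 2 / 3.
Proof.
have := @win_prob_rec 2 erefl.
rewrite !big_ord_recl big_ord0 /= /bump/= !addn0 win_prob0 win_prob1.
rewrite !add1n !bin1 binn !expr2; lra.
Qed.

Lemma win_prob3 : win_prob 3 = 5 / 7.
Proof.
have := @win_prob_rec 3 erefl.
rewrite !big_ord_recl big_ord0 /= /bump/= !add1n win_prob0 win_prob1 win_prob2.
by rewrite !bin1 binn (_ : 'C(3, 2) = 3%N)// !exprS expr0; lra.
Qed.

Lemma win_prob4 : win_prob 4 = 76 / 105.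
Proof.
have := @win_prob_rec 4 erefl.
rewrite !big_ord_recl big_ord0 /= /bump/= !add1n.
rewrite win_prob0 win_prob1 win_prob2 win_prob3.
rewrite !bin1 binn (_ : 'C(4, 2) = 6%N)// (_ : 'C(4, 3) = 4%N)//.
by rewrite !exprS expr0; lra.
Qed.

(** * Bounds on the winning probabilities by strong induction *)

Definition win_gap (a c e : R) k := a - c / 2 ^+ k + e * win_prob k.

(** The binomial transform multiplies constants by 2^n and, by the recursion, sends [win_prob] to
    2^n [win_prob n], but it sends 2^-k to (3/2)^n instead of 1. This mismatch is the gain. *)
Lemma win_gap_rec a c e n : (2 <= n)%N ->
  2 ^+ n * win_gap a c e n =
  c * ((3 / 2) ^+ n - 1) + \sum_(k < n.+1) 'C(n, k)%:R * win_gap a c e k.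
Proof.
move=> n2.
have S1 : \sum_(k < n.+1) 'C(n, k)%:R = 2 ^+ n :> R.
  by rewrite -[2]/(1 + 1 : R) exprDn; apply: eq_bigr => k _; rewrite !expr1n mul1r.
have S2 : \sum_(k < n.+1) 'C(n, k)%:R * (2 ^+ k)^-1 = (3 / 2) ^+ n :> R.
  rewrite (_ : 3 / 2 = 1 + 2^-1 :> R); last by lra.
  rewrite exprDn; apply: eq_bigr => k _.
  by rewrite expr1n mul1r exprVn mulr_natl.
have -> : \sum_(k < n.+1) 'C(n, k)%:R * win_gap a c e k =
   a * 2 ^+ n - c * (3 / 2) ^+ n + e * (2 ^+ n * win_prob n).
  rewrite win_prob_rec// -S1 -S2 !mulr_sumr -sumrN -!big_split/=.
  apply: eq_bigr => k _; rewrite /win_gap; ring.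
rewrite /win_gap; field.
by rewrite expf_neq0.
Qed.

Lemma win_gap_ge0 a c e :
  (forall n, (5 <= n)%N ->
     0 <= c * ((3 / 2) ^+ n - 1) + \sum_(k < 4) 'C(n, k)%:R * win_gap a c e k) ->
  0 <= win_gap a c e 4 -> forall n, (4 <= n)%N -> 0 <= win_gap a c e n.
Proof.
move=> H H4; elim/ltn_ind => n IH.
rewrite leq_eqVlt => /predU1P[<-//|n5].
have /eqP := @win_gap_rec a c e n (ltn_trans (isT : 1 < 4)%N n5).
(* The term k = n moves to the left, where d_n then has the positive factor 2^n - 1. *)
rewrite big_ord_recr/= binn mul1r addrA -subr_eq -{2}[win_gap a c e n]mul1r -mulrBl.
move=> /eqP E.
have p1 : 0 < 2 ^+ n - 1 :> R.
  by rewrite subr_gt0 exprn_egt1// ?ltr1n//; case: (n) n5.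
rewrite -(pmulr_rge0 _ p1) E; apply: (le_trans (H _ n5)); rewrite lerD2l.
rewrite -(big_mkord xpredT (fun k => 'C(n, k)%:R * win_gap a c e k)).
rewrite -(big_mkord xpredT (fun k => 'C(n, k)%:R * win_gap a c e k)).
rewrite [leRHS](big_cat_nat _ (n := 4))//=; last exact: ltnW.
rewrite lerDl big_nat_cond sumr_ge0// => k; rewrite andbT => /andP[k4 kn].
by rewrite mulr_ge0// IH.
Qed.

(** The binomial expansion of (1 + 1/2)^n, cut after k = 4. It is a combination of the C(n, k), as
    are the terms k < 4 it has to outweigh. *)
Lemma expr_three_halves_ge n : (5 <= n)%N ->
  1 + n%:R / 2 + 'C(n, 2)%:R / 4 + 'C(n, 3)%:R / 8 + 'C(n, 4)%:R / 16
  <= (3 / 2) ^+ n :> R.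
Proof.
move=> n5; rewrite (_ : 3 / 2 = 1 + 2^-1 :> R); last by lra.
rewrite exprDn (eq_bigr (fun k : 'I_n.+1 => 'C(n, k)%:R * (2 ^+ k)^-1)); last first.
  by move=> k _; rewrite expr1n mul1r exprVn mulr_natl.
rewrite -(big_mkord xpredT (fun k => 'C(n, k)%:R * (2 ^+ k)^-1)).
rewrite [leRHS](big_cat_nat _ (n := 5))//=; last exact: ltnW.
rewrite -[leLHS]addr0 lerD//; last first.
  by rewrite sumr_ge0// => k _; rewrite mulr_ge0// invr_ge0 exprn_ge0.
rewrite 5?big_ltn// big_geq// bin0 bin1 !exprS expr0.
by rewrite le_eqVlt; apply/orP; left; apply/eqP; field.
Qed.

Lemma win_gap_head a c e n :
  \sum_(k < 4) 'C(n, k)%:R * win_gap a c e k =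
  (a - c) + n%:R * (a - c / 2 + e) + 'C(n, 2)%:R * (a - c / 4 + e * (2 / 3))
  + 'C(n, 3)%:R * (a - c / 8 + e * (5 / 7)).
Proof.
rewrite !big_ord_recl big_ord0 /= /bump/= !add1n bin0 bin1.
rewrite /win_gap win_prob0 win_prob1 win_prob2 win_prob3 !exprS expr0.
by field.
Qed.

(** Vandermonde's identity for t + 5. In the basis C(t, k) it suffices to compare coefficients,
    since t >= 0 is arbitrary and every C(t, k) is nonnegative. *)
Lemma bin_add5 t :
  [/\ t.+4.+1%:R = t%:R + 5 :> R,
      'C(t.+4.+1, 2)%:R = 'C(t, 2)%:R + 5 * t%:R + 10 :> R,
      'C(t.+4.+1, 3)%:R = 'C(t, 3)%:R + 5 * 'C(t, 2)%:R + 10 * t%:R + 10 :> R &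
      'C(t.+4.+1, 4)%:R = 'C(t, 4)%:R + 5 * 'C(t, 3)%:R + 10 * 'C(t, 2)%:R
                           + 10 * t%:R + 5 :> R].
Proof.
rewrite -!natrM -!natrD; split; congr (_%:R); first by rewrite !addnS addn0.
all: by rewrite !binS !bin0 !bin1; ring.
Qed.

(** With n = t + 5, the four conditions are the coefficients of 1, t, C(t, 2) and C(t, 3) in the
    lower bound; that of C(t, 4) is c / 16. *)
Lemma win_head_ge0 a c e : 0 <= c ->
  let g0 := a - c in let g1 := a - c / 2 + e in
  let g2 := a - c / 4 + e * (2 / 3) in let g3 := a - c / 8 + e * (5 / 7) in
  [/\ 0 <= g0 + 5 * g1 + 10 * g2 + 10 * g3 + c * (105 / 16),
      0 <= g1 + 5 * g2 + 10 * g3 + c * (29 / 8),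
      0 <= g2 + 5 * g3 + c * (12 / 8) &
      0 <= g3 + c * (7 / 16)] ->
  forall n, (5 <= n)%N ->
  0 <= c * ((3 / 2) ^+ n - 1) + \sum_(k < 4) 'C(n, k)%:R * win_gap a c e k.
Proof.
move=> c0 g0 g1 g2 g3 [h0 h1 h2 h3] [|[|[|[|[|t]]]]]// n5.
have := expr_three_halves_ge n5; rewrite win_gap_head -/g0 -/g1 -/g2 -/g3.
have [-> -> -> ->] := bin_add5 t.
have := ler0n R t; have := ler0n R 'C(t, 2); have := ler0n R 'C(t, 3).
have := ler0n R 'C(t, 4).
move: (t%:R) ('C(t, 2)%:R) ('C(t, 3)%:R) ('C(t, 4)%:R) ((3 / 2) ^+ _).
move=> x1 x2 x3 x4 y x4_0 x3_0 x2_0 x1_0 /(ler_wpM2l c0) cy.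
have := mulr_ge0 x1_0 h1; have := mulr_ge0 x2_0 h2; have := mulr_ge0 x3_0 h3.
have := mulr_ge0 x4_0 c0.
rewrite mulrBr mulr1; move: (c * y) cy => z cy; lra.
Qed.

(** The two constants, 0.7142 and 0.7285, lie just inside 0.99 [alpha] and 1.01 [alpha]. The case n
    = 3 is separate because the lower gap is negative there. *)
Lemma win_prob_bounds n : (3 <= n)%N -> 3571 / 5000 <= win_prob n <= 1457 / 2000.
Proof.
rewrite leq_eqVlt => /predU1P[<-|n4].
  by rewrite win_prob3; apply/andP; split; lra.
(* The base case n = 4 bounds c above by 16 (1457/2000 - 76/105), and by 16 (76/105 - 3571/5000) for
   the lower bound; 3/40 and 3/20 lie just below these. *)
have U : 0 <= win_gap (1457 / 2000) (3 / 40) (-1) n.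
  apply: win_gap_ge0 n4; last by rewrite /win_gap win_prob4 !exprS expr0; lra.
  by apply: win_head_ge0; [|split]; lra.
have L : 0 <= win_gap (- (3571 / 5000)) (3 / 20) 1 n.
  apply: win_gap_ge0 n4; last by rewrite /win_gap win_prob4 !exprS expr0; lra.
  by apply: win_head_ge0; [|split]; lra.
have : 0 <= (2 ^+ n)^-1 :> R by rewrite invr_ge0 exprn_ge0.
move: U L; rewrite /win_gap; move: (win_prob n) ((2 ^+ n)^-1) => p q U L q0.
by apply/andP; split; lra.
Qed.

Lemma alpha_eq : alpha R = (72 * 100 + 13) / 10 ^+ 4.
Proof. by rewrite /alpha -natrM -natrD. Qed.

Lemma alpha_gt0 : 0 < alpha R.
Proof. by rewrite alpha_eq divr_gt0 ?exprn_gt0//; lra. Qed.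

Lemma beta_bound n : (3 <= n)%N -> `|beta_ R n - 1| <= 1 / 100.
Proof.
move=> n3; have /andP[] := win_prob_bounds n3.
rewrite /beta_ alpha_win_prob ?(ltnW n3)//; move: (win_prob n) => p.
have := alpha_eq; have := alpha_gt0; move: (alpha R) => a.
rewrite !exprS expr0 => a0 aE pL pU.
rewrite ler_norml lerBrDr lerBlDr (ler_pdivlMr _ _ a0) (ler_pdivrMr _ _ a0).
by apply/andP; split; lra.
Qed.

End alpha_bounds.

(** * The event delta = 1 as the existence of a winner, for fixed ranks *)

Section winner.
Context (I : choiceType) (r : I -> int).
Hypothesis r_ge0 : forall v, 0 <= r v.
Implicit Types A B : {fset I}.

Lemma le_reg_max A w : w \in A -> r w <= reg_max r A.
Proof. by move=> wA; rewrite /reg_max; apply: le_bigmax_seq. Qed.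

Lemma reg_max_attained A : A != fset0 -> exists2 w, w \in A & reg_max r A = r w.
Proof.
move=> /fset0Pn[a aA]; rewrite /reg_max.
suff [w wA Ew] : exists2 w, w \in (A : seq I) & \big[Num.max/0]_(v <- A) r v = r w.
  by exists w.
have : (a \in (A : seq I)) by [].
elim: (A : seq I) a {aA} => // x s IH a _; rewrite big_cons.
case: s IH => [_|y s IH].
  (* Nonnegative ranks keep the default 0 from exceeding the last rank. *)
  by exists x; [exact: mem_head|rewrite big_nil max_l].
have [w ws ->] := IH y (mem_head _ _).
have [xw|wx] := leP (r x) (r w); [exists w|exists x] => //.
  by rewrite inE ws orbT.
by rewrite mem_head.
Qed.

(** A unique maximiser of A whose rank exceeds all ranks in B is a strict maximiser over the union,
    and it cannot lie in B. *)
Lemma reg_flag_winnerP A B : A != fset0 -> B != fset0 ->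
  (reg_max r B < reg_max r A) && (reg_flag r A == 1) <->
  exists w, [/\ w \in A, w \notin B &
    forall v, v \in (A `|` B)%fset -> v != w -> r v < r w].
Proof.
move=> A0 B0; rewrite /reg_flag; split.
  move=> /andP[BA]; case: ifPn => // /cardfs1P[w Ew] _.
  have wmax v : (v == w) = (v \in A) && (r v == reg_max r A).
    by rewrite -in_fset1 -Ew !inE.
  have /andP[wA /eqP rw] : (w \in A) && (r w == reg_max r A) by rewrite -wmax.
  exists w; split=> //.
    by apply/negP => wB; have := le_lt_trans (le_reg_max wB) BA; rewrite rw ltxx.
  move=> v; rewrite inE => /orP[vA vw|vB _]; rewrite rw.
    by rewrite lt_neqAle le_reg_max// andbT; move: vw; rewrite wmax vA.
  exact: le_lt_trans (le_reg_max vB) BA.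
move=> [w [wA wB wlt]].
have rw : reg_max r A = r w.
  have [v vA Ev] := reg_max_attained A0.
  have [<-//|vw] := eqVneq v w.
  have /wlt/(_ vw) : v \in (A `|` B)%fset by rewrite inE vA.
  by rewrite -Ev ltNge le_reg_max.
have -> /= : reg_max r B < reg_max r A.
  have [v vB ->] := reg_max_attained B0.
  rewrite rw wlt// ?inE ?vB ?orbT//.
  by apply: contraNneq wB => <-.
have -> : [fset v in A | r v == reg_max r A]%fset = [fset w]%fset.
  apply/fsetP => v; rewrite !inE rw.
  have [->|vw] := eqVneq v w; first by rewrite wA eqxx.
  apply/negP => /andP[vA]; rewrite lt_eqF// wlt// inE vA//.
by rewrite cardfs1.
Qed.

Lemma delta_eq1E A B : (delta r A B == 1)%N =
  ((reg_max r B < reg_max r A) && (reg_flag r A == 1)) ||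
  ((reg_max r A < reg_max r B) && (reg_flag r B == 1)).
Proof.
rewrite /delta /chi /psi.
by case: (ltgtP (reg_max r A) (reg_max r B)) => //= _; rewrite ?orbF mul1n eqb1.
Qed.

Lemma delta_winnerP A B : A != fset0 -> B != fset0 ->
  (delta r A B == 1)%N <->
  exists2 w, w \in ((A `|` B) `\` (A `&` B))%fset &
    forall v, v \in (A `|` B)%fset -> v != w -> r v < r w.
Proof.
move=> A0 B0; rewrite delta_eq1E; split.
  move=> /orP[] /reg_flag_winnerP => [/(_ A0 B0)|/(_ B0 A0)] [w [wA wB wlt]].
    by exists w => //; rewrite !inE wA (negbTE wB).
  by exists w; [rewrite !inE wA (negbTE wB) orbT|rewrite fsetUC].
move=> [w]; rewrite !inE => /andP[wI wU] wlt; apply/orP.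
have [wA|wA] := boolP (w \in A).
  by left; apply/reg_flag_winnerP => //; exists w; move: wI; rewrite wA.
right; apply/reg_flag_winnerP => //; exists w; split=> //.
  by move: wU; rewrite (negbTE wA).
by rewrite fsetUC.
Qed.

End winner.

(** * Mean and variance of a count of pairwise independent events *)

Section uncorrelated_indicators.
Context d (T : measurableType d) (R : realType) (P : probability T R).

Lemma Lfun_indic (A : set T) : measurable A -> (\1_A : T -> R) \in Lfun P 2%:E.
Proof.
move=> mA; rewrite inE; apply/andP; split; rewrite inE/=.
  exact: measurable_realfun.measurable_indic.
rewrite /finite_norm unlock /Lnorm poweR_lty//.
have -> : (fun x => `|(\1_A x : R)%:E| `^ 2)%E = (fun x => (\1_A x : R)%:E).
  apply/funext => x; rewrite indicE; case: (x \in A) => /=.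
    by rewrite normr1 powR1.
  by rewrite normr0 powR0.
by rewrite integral_indic// setIT (le_lt_trans (probability_le1 _ mA))// ltry.
Qed.

(** The product of two indicators is the indicator of the intersection. The case A = B gives the
    variance. *)
Lemma covariance_indic (A B : set T) (p : R) : measurable A -> measurable B ->
  P A = p%:E -> P B = p%:E ->
  covariance P (\1_A : T -> R) \1_B = (P (A `&` B) - (p ^+ 2)%:E)%E.
Proof.
move=> mA mB PA PB.
have Pfin : P setT \is a fin_num := fin_num_measure P _ measurableT.
have mAB := measurableI _ _ mA mB.
have [LA LB] := (Lfun_indic mA, Lfun_indic mB).
rewrite covarianceE ?(Lfun2_mul_Lfun1 LA LB) ?(Lfun_subset12 Pfin)//.
rewrite !expectation_indic// PA PB -EFinM -expr2 -(expectation_indic P mAB).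
by congr ('E_P[_] - _)%E; rewrite indicI.
Qed.

Context (k : nat) (D : 'I_k -> set T) (p : R).
Hypothesis mD : forall i, measurable (D i).
Hypothesis PD : forall i, P (D i) = p%:E.
Hypothesis PDD : forall i j, i != j -> P (D i `&` D j) = (p ^+ 2)%:E.

(** Summing over a list allows induction on it; the variance also needs the list to be
    duplicate-free. *)
Let count (s : seq 'I_k) : T -> R := \sum_(i <- s) \1_(D i).

Let Lcount s : count s \in Lfun P 2%:E.
Proof.
rewrite /count; elim: s => [|i s IH]; first by rewrite big_nil Lfun_cst.
by rewrite big_cons rpredD ?lee1n// => ?; exact: Lfun_indic.
Qed.

Let expectation_count s : ('E_P[count s] = ((size s)%:R * p)%:E)%E.
Proof.
have Pfin : P setT \is a fin_num := fin_num_measure P _ measurableT.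
elim: s => [|i s IH].
  by rewrite /count big_nil mul0r (expectation_cst P 0).
have L1 := Lfun_subset12 Pfin (Lfun_indic (mD i)).
have L2 := Lfun_subset12 Pfin (Lcount s).
rewrite /count big_cons expectationD//.
by rewrite expectation_indic// PD [X in (_ + X)%E]IH -EFinD/= -natr1 mulrDl mul1r addrC.
Qed.

Let variance_count s : uniq s ->
  ('V_P[count s] = ((size s)%:R * (p * (1 - p)))%:E)%E.
Proof.
elim: s => [_|i s IH /= /andP[is_ us]].
  by rewrite /count big_nil mul0r (variance_cst P 0).
have L1 := Lfun_indic (mD i); have L2 := Lcount s.
rewrite /count big_cons varianceD//.
have -> : covariance P (\1_(D i)) (\sum_(j <- s) \1_(D j) : T -> R) = 0%E.
  elim: s is_ {us IH L2} => [|j s IH]; first by rewrite big_nil (covariance_cst_r P _ 0).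
  rewrite inE negb_or => /andP[ij is_].
  have Lj := Lfun_indic (mD j); have Ls := Lcount s.
  rewrite big_cons covarianceDr//.
  by rewrite IH// (covariance_indic (mD i) (mD j) (PD i) (PD j)) PDD// adde0 -EFinB subrr.
rewrite mule0 adde0 [X in (_ + X)%E]IH// /variance.
rewrite (covariance_indic (mD i) (mD i) (PD i) (PD i)) setIid PD.
by rewrite -!EFinD -natr1; congr (_%:E); ring.
Qed.

Lemma expectation_affine_count (a c : R) :
  ('E_P[(fun t => a - c * \sum_(i < k) \1_(D i) t)%R] = (a - c * (k%:R * p))%:E)%E.
Proof.
have Pfin : P setT \is a fin_num := fin_num_measure P _ measurableT.
pose N := count (enum 'I_k).
have -> : (fun t => a - c * \sum_(i < k) \1_(D i) t) = (cst a \- c \o* N).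
  by apply/funext => t /=; rewrite mulrC /N /count big_enum/= fct_sumE.
have LN := Lfun_subset12 Pfin (Lcount (enum 'I_k)).
rewrite expectationB ?Lfun_cst ?Lfun_scale//.
rewrite expectation_cst expectationZl//.
by rewrite expectation_count size_enum_ord -EFinM -EFinB.
Qed.

Lemma variance_affine_count (a c : R) :
  ('V_P[(fun t => a - c * \sum_(i < k) \1_(D i) t)%R] =
  (c ^+ 2 * (k%:R * (p * (1 - p))))%:E)%E.
Proof.
pose N := count (enum 'I_k).
have -> : (fun t => a - c * \sum_(i < k) \1_(D i) t) = (cst a \- c \o* N).
  by apply/funext => t /=; rewrite mulrC /N /count big_enum/= fct_sumE.
have LN := Lcount (enum 'I_k).
rewrite varianceB_cst_l ?Lfun_scale ?ler1n//.
by rewrite varianceZ// variance_count ?enum_uniq// size_enum_ord -EFinM.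
Qed.

End uncorrelated_indicators.

(** * Ranks as dyadic intervals of hash values, and their uniform probabilities *)

Section hash_rank.
Variable R : realType.
Implicit Types (x : R) (j : nat).

Lemma hash_rank_lt x j : 0 < x < 1 -> (hash_rank x < j%:Z) = ((2 ^+ j)^-1 < x).
Proof.
move=> /andP[x0 x1]; rewrite /hash_rank floor_lt_int /log2 -mulNr.
have ln2 : 0 < ln 2 :> R by rewrite ln_gt0// ltr1n.
rewrite ltr_pdivrMr// -pmulrn mulr_natl -lnXn// ltrNl -lnV ?posrE ?exprn_gt0//.
by rewrite ltr_ln ?posrE ?invr_gt0 ?exprn_gt0.
Qed.

Lemma hash_rank_ge0 x : 0 < x < 1 -> 0 <= hash_rank x.
Proof.
move=> x01; rewrite leNgt (hash_rank_lt 0 x01) expr0 invr1 -leNgt.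
by case/andP: x01 => _ /ltW.
Qed.

Lemma hash_rank_eq x j : 0 < x < 1 ->
  (hash_rank x == j%:Z) = ((2 ^+ j.+1)^-1 < x <= (2 ^+ j)^-1).
Proof.
move=> x01; rewrite -(hash_rank_lt _ x01) leNgt -(hash_rank_lt _ x01).
by rewrite -leNgt intS addrC ltzD1 eq_le.
Qed.

Lemma uniform_prob01_itv (a b : R) : 0 <= a -> a <= b -> b <= 1 ->
  uniform_prob (@ltr01 R) `]a, b] = (b - a)%:E.
Proof.
move=> a0 ab b1; rewrite /uniform_prob integral_uniform_pdf.
have -> : [set` `]a, b]] `&` [set` `[0, 1]] = [set` `]a, b]] :> set R.
  apply/seteqP; split => x /=; first by case.
  move=> xab; split => //; move: xab; rewrite !in_itv/= => /andP[ax xb].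
  by rewrite (le_trans a0 (ltW ax)) (le_trans xb b1).
rewrite (eq_integral (fun=> 1%:E)) => [|x]; last first.
  rewrite inE/= in_itv/= => /andP[ax xb].
  by rewrite /uniform_pdf (le_trans a0 (ltW ax)) (le_trans xb b1) subr0 invr1.
rewrite integral_cst//= mul1e lebesgue_measure_itv/= lte_fin.
by move: ab; rewrite le_eqVlt => /predU1P[->|->]; rewrite ?ltxx ?subrr// EFinB.
Qed.

Lemma uniform_prob01_ge (a : R) : 0 <= a -> a <= 1 ->
  uniform_prob (@ltr01 R) `]a, +oo[ = (1 - a)%:E.
Proof.
move=> a0 a1; rewrite -(uniform_prob01_itv a0 a1 (lexx _)).
rewrite /uniform_prob integral_uniform_pdf [RHS]integral_uniform_pdf.
suff -> : [set` `]a, +oo[] `&` [set` `[0, 1]] =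
    [set` `]a, 1]] `&` [set` `[0, 1]] :> set R.
  by [].
apply/seteqP; split => x /=; rewrite !in_itv/= ?andbT.
  by move=> [ax /andP[x0 x1]]; rewrite ax x0 x1.
by move=> [/andP[ax _] ->].
Qed.

End hash_rank.

(** * The probability that a given item wins at a given rank *)

Section rank_event.
Context d (T : measurableType d) (R : realType) (P : probability T R).
Context (I : choiceType) (X : I -> {RV P >-> R}) (S : {fset I}).
Hypothesis X01 : forall v t, 0 < X v t < 1.
Hypothesis X_unif : forall v, uniform01 (X v).
Hypothesis X_indep : independent_rvs P (fun v => X v : T -> R).

Let rank t v : int := hash_rank (X v t).

(** The hash values giving w rank j and every other item a rank below j. One condition per item lets
    the product rule apply. *)
Definition rank_set (w : I) (j : nat) (v : I) : set R :=
  if v == w then [set` `](2 ^+ j.+1)^-1, (2 ^+ j)^-1]] else [set` `](2 ^+ j)^-1, +oo[].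

Definition rank_event (w : I) (j : nat) : set T :=
  \bigcap_(v in [set` S]) (X v @^-1` rank_set w j v).

Lemma measurable_rank_set w j v : measurable (rank_set w j v).
Proof. by rewrite /rank_set; case: ifP => _; exact: measurable_itv. Qed.

Lemma sigma_rv_rank w j v : sigma_rv (X v) (X v @^-1` rank_set w j v).
Proof.
by exists (rank_set w j v); [exact: measurable_rank_set|rewrite setTI].
Qed.

Lemma rank_eventP w j t : w \in S ->
  rank_event w j t <->
  (rank t w = j /\ forall v, v \in S -> v != w -> rank t v < j%:Z).
Proof.
move=> wS; split.
  move=> E; split.
    have := E w wS; rewrite /preimage /rank_set eqxx/= in_itv/= -hash_rank_eq//.
    by move=> /eqP.
  move=> v vS vw; have := E v vS.
  by rewrite /preimage /rank_set (negbTE vw)/= in_itv/= andbT hash_rank_lt.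
move=> [rw rv] v /= vS; rewrite /preimage /rank_set; case: eqVneq => [->|vw] /=.
  by rewrite in_itv/= -hash_rank_eq//; apply/eqP.
by rewrite in_itv/= andbT -hash_rank_lt// rv.
Qed.

(** By independence, w contributes the interval length 2^-j - 2^-(j+1) = 2^-(j+1), and each of the
    other items of S contributes 1 - 2^-j. *)
Lemma prob_rank_event w j : w \in S ->
  P (rank_event w j) = (win_term R #|` S|.-1 j)%:E.
Proof.
move=> wS; rewrite /rank_event.
rewrite (X_indep (fun v _ => sigma_rv_rank w j v)).
have [p0 p1] := (fun n => (inv_exp2_itv R n).1, fun n => (inv_exp2_itv R n).2).
have Pv v : P (X v @^-1` rank_set w j v) =
    (if v == w then (2 ^+ j.+1)^-1 else 1 - (2 ^+ j)^-1)%:E.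
  have := X_unif v (measurable_rank_set w j v); rewrite /distribution /pushforward => ->.
  rewrite /rank_set; case: eqVneq => _; last by rewrite uniform_prob01_ge //.
  rewrite uniform_prob01_itv//.
    by congr (_%:E); rewrite exprS; field; rewrite expf_neq0.
  by rewrite lef_pV2 ?posrE ?exprn_gt0// ler_weXn2l// ler1n.
rewrite (eq_bigr _ (fun v _ => Pv v)) -(big_morph _ (@EFinM R) erefl).
congr (_%:E).
rewrite (big_fsetD1 w)//= eqxx /win_term; congr (_ * _).
rewrite (eq_big_seq (fun=> 1 - (2 ^+ j)^-1)); last first.
  by move=> v; rewrite !inE => /andP[/negbTE->].
by rewrite big_const_seq count_predT iter_mulr_1 (cardfsD1 w S) wS.
Qed.

End rank_event.

Lemma sigma_random_fun_measurable d (T : measurableType d) (R : realType)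
    (P : probability T R) (V : Type) (X : V -> {RV P >-> R}) (A : set T) :
  sigma_random_fun (fun v => X v : T -> R) A -> measurable A.
Proof.
apply: smallest_sub; first exact: sigma_algebra_measurable.
move=> B [v _ [C mC <-]].
by rewrite setTI -[X in measurable X]setTI; exact: measurable_funP.
Qed.

(** * The probability of detection by one hash function *)

Section detection_event.
Context d (T : measurableType d) (R : realType) (P : probability T R).
Context (I : choiceType) (X : I -> {RV P >-> R}) (I1 I2 : {fset I}).
Hypothesis I1_neq0 : I1 != fset0.
Hypothesis I2_neq0 : I2 != fset0.
Hypothesis X01 : forall v t, 0 < X v t < 1.
Hypothesis X_unif : forall v, uniform01 (X v).
Hypothesis X_indep : independent_rvs P (fun v => X v : T -> R).

Let S := (I1 `|` I2)%fset.
Let W := (S `\` (I1 `&` I2))%fset.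

Definition detection : set T :=
  [set t | (delta (fun v => hash_rank (X v t)) I1 I2 == 1)%N].

Let W_S w : w \in W -> w \in S.
Proof. by rewrite inE => /andP[]. Qed.

Let E w : set T := \bigcup_j rank_event X S w j.

Lemma detectionE : detection = \bigcup_(w in [set` W]) E w.
Proof.
have r0 t v : 0 <= hash_rank (X v t) by exact: hash_rank_ge0.
apply/seteqP; split => t.
  move=> /(delta_winnerP (r0 t) I1_neq0 I2_neq0)[w wW wmax].
  (* The rank of w is nonnegative, so its absolute value is the rank itself. *)
  exists w => //; exists `|hash_rank (X w t)|%N => //.
  apply/rank_eventP => //; first exact: W_S.
  by rewrite gez0_abs//; split => // v vS vw; exact: wmax.
move=> [w wW [j _ /(rank_eventP X01 _ _ (W_S wW))[rw rlt]]].
apply/(delta_winnerP (r0 t) I1_neq0 I2_neq0); exists w => // v vS vw.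
by rewrite rw rlt.
Qed.

Lemma sigma_rank_event w j :
  sigma_random_fun (fun v => X v : T -> R) (rank_event X S w j).
Proof.
rewrite /rank_event.
apply: (@fin_bigcap_measurable _
  (g_sigma_algebraType (\bigcup_v sigma_rv (X v : T -> R)))) => // v _.
by apply: sub_sigma_algebra; exists v => //; exact: sigma_rv_rank.
Qed.

(** Independence of the hash functions concerns events of their generated sigma-algebras. Detection
    is one: a finite union over winners of countable unions over ranks. *)
Lemma sigma_detection : sigma_random_fun (fun v => X v : T -> R) detection.
Proof.
rewrite detectionE.
apply: (@fin_bigcup_measurable _
  (g_sigma_algebraType (\bigcup_v sigma_rv (X v : T -> R)))) => // w _.
by apply: sigma_algebra_bigcup => j; exact: sigma_rank_event.
Qed.

Let measurable_rank_event w j : measurable (rank_event X S w j).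
Proof. exact: sigma_random_fun_measurable (sigma_rank_event w j). Qed.

Let trivIset_rank_event w : w \in S -> trivIset setT (rank_event X S w).
Proof.
move=> wS; apply/trivIsetP => i j _ _ ij; apply/seteqP; split => // t [].
move=> /(rank_eventP X01 _ _ wS)[ri _] /(rank_eventP X01 _ _ wS)[rj _].
by move: ij; rewrite -eqz_nat -ri -rj eqxx.
Qed.

(** Two distinct winners would each have a rank strictly below the other's. *)
Let trivIset_winner : trivIset [set` W] E.
Proof.
apply/trivIsetP => v w vW wW vw; apply/seteqP; split => // t [].
move=> [i _ /(rank_eventP X01 _ _ (W_S vW))[rv lev]].
move=> [j _ /(rank_eventP X01 _ _ (W_S wW))[rw lew]].
have := lev w (W_S wW); rewrite eq_sym vw => /(_ isT).
have := lew v (W_S vW) vw.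
by rewrite rv rw => /lt_trans /[apply]; rewrite ltxx.
Qed.

Let prob_winner w : w \in S ->
  P (E w) = (limn (series (win_term R #|` S|.-1)))%:E.
Proof.
move=> wS; rewrite measure_semi_bigcup//; last 2 first.
- exact: trivIset_rank_event.
- by apply: bigcupT_measurable.
rewrite -EFin_lim; last exact: is_cvg_series_win.
apply: (congr1 (fun u : nat -> \bar R => limn u)); apply/funext => N /=.
by rewrite /series/= -sumEFin; apply: eq_bigr => j _; exact: prob_rank_event.
Qed.

(** The candidates win disjointly, each with the same probability alpha_n / n, and the symmetric
    difference contains n (1 - J) of them. *)
Lemma prob_detection : (2 <= #|` S|)%N ->
  P detection = (alpha_ R #|` S| * (1 - jaccard R I1 I2))%:E.
Proof.
move=> n2; rewrite detectionE measure_fin_bigcup//; last first.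
  by move=> w wW; apply: bigcupT_measurable.
rewrite -fsbig_seq//= (eq_big_seq _ (fun w wW => prob_winner (W_S wW))).
rewrite sumEFin big_const_seq count_predT iter_addr_0; congr (_%:E).
rewrite alpha_win_prob// /win_prob /jaccard -/S -[LHS]mulr_natl.
have -> : #|` W| = (#|` S| - #|` I1 `&` I2|%fset)%N.
  rewrite cardfsD (fsetIidPr _)//.
  by apply/fsubsetP => v; rewrite !inE => /andP[->].
have cI : (#|` I1 `&` I2|%fset <= #|` S|)%N.
  by apply/fsubset_leq_card/fsubsetP => v; rewrite !inE => /andP[->].
rewrite natrB//; field.
by rewrite pnatr_eq0 -lt0n (leq_trans _ n2).
Qed.

End detection_event.

(** * Mean, variance and bias of the estimator *)

Theorem theorem2 (R : realType) (d : measure_display) (T : measurableType d)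
    (P : probability T R) (I : choiceType) (I1 I2 : {fset I})
    (k : nat) (h : 'I_k -> I -> {RV P >-> R})
    (hk : (0 < k)%N)
    (hI1 : I1 != fset0) (hI2 : I2 != fset0) (hn : (2 <= #|` (I1 `|` I2)%fset |)%N)
    (h01 : forall (i : 'I_k) (v : I) (t : T), 0 < h i v t < 1)
    (hunif : forall (i : 'I_k) (v : I), uniform01 (h i v))
    (hvals : forall i : 'I_k, independent_rvs P (fun v => h i v : T -> R))
    (hfuns : independent_random_funs P (fun i v => h i v : T -> R)) :
  let n : nat := #|` (I1 `|` I2)%fset | in
  let J : R := jaccard R I1 I2 in
  let Jh : T -> R := Jhat (fun i v => h i v : T -> R) I1 I2 in
  [/\ ('E_P[Jh] - J%:E = ((1 - beta_ R n) * (1 - J))%:E)%E,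
      ('V_P[Jh] =
         (beta_ R n * (1 - J) * ((alpha R)^-1 - beta_ R n * (1 - J)) / k%:R)%:E)%E
    & (3 <= n)%N -> `|beta_ R n - 1| <= 1 / 100].
Proof.
move=> n J Jh.
pose D i := detection (h i) I1 I2.
have sD i : sigma_random_fun (fun v => h i v : T -> R) (D i).
  exact: sigma_detection.
have mD i : measurable (D i) by exact: sigma_random_fun_measurable (sD i).
set p := alpha_ R n * (1 - J).
have PD i : P (D i) = p%:E by exact: prob_detection.
have PDD i j : i != j -> P (D i `&` D j) = (p ^+ 2)%:E.
  (* The product rule on the two-element subfamily gives pairwise independence. *)
  move=> ij; have := hfuns [fset i; j]%fset D (fun i _ => sD i).
  rewrite big_fsetU1 ?inE// big_seq_fset1 !PD [X in _ = X -> _]/= -EFinM -expr2 => <-.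
  congr (P _); apply/seteqP; split => t /=.
    by move=> [Di Dj] x /=; rewrite !inE => /orP[]/eqP->.
  by move=> H; split; apply: H; rewrite /= !inE eqxx ?orbT.
have JhE : Jh = (fun t => 1 - (k%:R * alpha R)^-1 * \sum_(i < k) \1_(D i) t).
  apply/funext => t; rewrite /Jh /Jhat /khat mulrC natr_sum.
  congr (_ - _ * _); apply: eq_bigr => i _.
  by rewrite indicE mem_setE.
have k0 : k%:R != 0 :> R by rewrite pnatr_eq0 -lt0n.
have a0 : alpha R != 0 by rewrite gt_eqF// alpha_gt0.
split; last exact: beta_bound.
  rewrite JhE (expectation_affine_count mD PD) -EFinB /p /beta_; congr (_%:E).
  (* The factor k cancels, and p / [alpha] = beta_n (1 - J). *)
  by field; rewrite k0 a0.
rewrite JhE (variance_affine_count mD PD PDD) /p /beta_; congr (_%:E).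
(* The variance p (1 - p) / (k [alpha]^2) factors as p / [alpha] times (1 - p) / [alpha], divided by
   k. *)
by field; rewrite k0 a0.
Qed.
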